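(* Let $r\in\mathbb{N}$, $x\in\mathbb{C}$, and $\lambda\in\mathbb{C}$ with $|\lambda|<1$. Then $$\sum_{n=0}^{\infty}\Phi^{E,r}_{M,\lambda}(-n,x)\frac{t^n}{M_n!}=\frac{e_M^{xt}}{(1+\lambda e_M^t)^r}$$ for all complex $t$ in a neighborhood of $0$ on which $|\lambda e_M^t|<1$ (that is, there is a neighborhood $U$ of $0$ in $\mathbb{C}$ such that for every $t\in U$ one has $|\lambda e_M^t|<1$ and the identity holds).
   Context: $\mathbb{N}=\{1,2,\ldots\}$, $\mathbb{N}_0=\{0,1,2,\ldots\}$. For $n\ge 0$, $M_n=2^n-1$. The M-factorial is $M_0!=1$ and $M_n!=M_nM_{n-1}\cdots M_1$ for $n\geq 1$. The M-exponential is $e_M^{xt}=\sum_{n=0}^{\infty}\frac{x^nt^n}{M_n!}$, and $e_M^t$ denotes the case $x=1$. For $m\in\mathbb{N}_0$ the Mersenne translation polynomials $P_{n,M}(x;m)$ are defined by $e_M^{xt}\left(e_M^t\right)^m=\sum_{n=0}^{\infty}P_{n,M}(x;m)\frac{t^n}{M_n!}$, where $(e_M^t)^m$ is the ordinary $m$-fold product. For $r\in\mathbb{N}$, $n\in\mathbb{N}_0$, $x\in\mathbb{C}$ and $|\lambda|<1$, the Euler-type Mersenne-Lerch interpolation value of order $r$ at $-n$ is the (convergent) series $\Phi^{E,r}_{M,\lambda}(-n,x)=\sum_{m=0}^{\infty}(-1)^m\binom{m+r-1}{m}\lambda^mP_{n,M}(x;m)$, where $\binom{m+r-1}{m}$ is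 the ordinary binomial coefficient and $\lambda^0=1$. *)

(* Defs.v *)
From Stdlib Require Import Reals Lra Lia.
From Coquelicot Require Import Coquelicot.
Open Scope R_scope.

(** Sum of a complex series, in the style of Coquelicot's total operator
    [Series]; it is the sum whenever the series converges
    (see [is_series_CSeries] below). *)
Definition CSeries (a : nat -> C) : C :=
  (Series (fun n => Re (a n)), Series (fun n => Im (a n))).

Definition Mersenne (n : nat) : nat := (2 ^ n - 1)%nat.

Fixpoint Mfact (n : nat) : nat :=
  match n with
  | O => 1%nat
  | S p => (Mersenne (S p) * Mfact p)%nat
  end.

(** [INR (Mfact n)] as a complex number. *)
Definition CMfact (n : nat) : C := RtoC (INR (Mfact n)).

(** [eM z] is the entire function e_M^z; thus e_M^{xt} is [eM (x * t)]. *)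
Definition eM (z : C) : C := CSeries (fun n => z ^ n / CMfact n)%C.

(** Cauchy product of coefficient sequences: the complex version of
    Coquelicot's [PS_mult]. *)
Definition CPS_mult (a b : nat -> C) (n : nat) : C :=
  sum_n (fun k => a k * b (n - k)%nat)%C n.

(** Taylor coefficients in t of e_M^{xt}. *)
Definition eM_coef (x : C) (n : nat) : C := (x ^ n / CMfact n)%C.

(** Taylor coefficients in t of e_M^{xt} (e_M^t)^m. *)
Fixpoint MT_coef (x : C) (m : nat) : nat -> C :=
  match m with
  | O => eM_coef x
  | S p => CPS_mult (MT_coef x p) (eM_coef 1)
  end.

(** Mersenne translation polynomial P_{n,M}(x;m): M_n! times the n-th Taylor
    coefficient of its generating function (see [MTpoly_generating] below). *)
Definition MTpoly (n : nat) (x : C) (m : nat) : C :=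
  (CMfact n * MT_coef x m n)%C.

(** The value Phi^{E,r}_{M,lam}(-n, x). The series converges absolutely when
    [Cmod lam < 1], since [MTpoly n x m] grows polynomially in [m]. *)
Definition PhiE (r : nat) (lam : C) (n : nat) (x : C) : C :=
  CSeries (fun m =>
    (- RtoC 1) ^ m * RtoC (Binomial.C (m + r - 1) m) * lam ^ m
    * MTpoly n x m)%C.

(** ** Complex series *)

Notation is_Cseries := (@is_series C_AbsRing C_NormedModule).

Lemma Re_sum_n (a : nat -> C) n :
  Re (sum_n a n) = sum_n (fun k => Re (a k)) n.
Proof.
  induction n as [|n IH].
  - now rewrite !sum_O.
  - rewrite !sum_Sn, <- IH. reflexivity.
Qed.

Lemma Im_sum_n (a : nat -> C) n :
  Im (sum_n a n) = sum_n (fun k => Im (a k)) n.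
Proof.
  induction n as [|n IH].
  - now rewrite !sum_O.
  - rewrite !sum_Sn, <- IH. reflexivity.
Qed.

Lemma is_Cseries_iff (a : nat -> C) (l : C) :
  is_Cseries a l <->
  is_series (fun n => Re (a n)) (Re l) /\ is_series (fun n => Im (a n)) (Im l).
Proof.
  split.
  - intros H. split; apply filterlim_locally; intros eps;
      generalize (proj1 (filterlim_locally (F := eventually)
        (U := C_UniformSpace) (sum_n a) l) H eps);
      apply filter_imp; intros n [H1 H2].
    + rewrite <- Re_sum_n. exact H1.
    + rewrite <- Im_sum_n. exact H2.
  - intros [H1 H2].
    apply (filterlim_locally (F := eventually) (U := C_UniformSpace)).
    intros eps.
    generalize (proj1 (filterlim_locally _ _) H1 eps).
    intros K1. generalize (proj1 (filterlim_locally _ _) H2 eps). intros K2.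
    generalize (filter_and _ _ K1 K2). apply filter_imp.
    intros n [J1 J2]. split.
    + change (ball (Re l) eps (Re (sum_n a n))). now rewrite Re_sum_n.
    + change (ball (Im l) eps (Im (sum_n a n))). now rewrite Im_sum_n.
Qed.

Lemma is_series_CSeries (a : nat -> C) (l : C) :
  is_Cseries a l -> CSeries a = l.
Proof.
  intros [H1 H2]%is_Cseries_iff. unfold CSeries.
  rewrite (is_series_unique _ _ H1), (is_series_unique _ _ H2).
  now destruct l.
Qed.

Lemma im_le_Cmod (z : C) : Rabs (Im z) <= Cmod z.
Proof. apply Rle_trans with (2 := Rmax_Cmod z). apply Rmax_r. Qed.

Lemma ex_series_Re_Im (a : nat -> C) :
  ex_series (fun n => Cmod (a n)) ->
  ex_series (fun n => Rabs (Re (a n))) /\ ex_series (fun n => Rabs (Im (a n))).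
Proof.
  intros H.
  split; apply (@ex_series_le R_AbsRing R_CompleteNormedModule) with (2 := H);
    intros n; unfold norm; simpl; unfold abs; simpl; rewrite Rabs_Rabsolu.
  - apply re_le_Cmod.
  - apply im_le_Cmod.
Qed.

Lemma CSeries_correct (a : nat -> C) :
  ex_series (fun n => Cmod (a n)) -> is_Cseries a (CSeries a).
Proof.
  intros [H1 H2]%ex_series_Re_Im.
  apply is_Cseries_iff; split; apply Series_correct, ex_series_Rabs; assumption.
Qed.

Lemma Cmod_sum_n (a : nat -> C) n :
  Cmod (sum_n a n) <= sum_n (fun k => Cmod (a k)) n.
Proof.
  induction n as [|n IH].
  - rewrite !sum_O. apply Rle_refl.
  - rewrite !sum_Sn. apply Rle_trans with (1 := Cmod_triangle _ _).
    apply Rplus_le_compat_r, IH.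
Qed.

Lemma CPS_mult_abs (a b : nat -> C) :
  ex_series (fun n => Cmod (a n)) -> ex_series (fun n => Cmod (b n)) ->
  ex_series (fun n => Cmod (CPS_mult a b n)).
Proof.
  intros Ha Hb.
  assert (Ha' : ex_series (fun n => Rabs (Cmod (a n)))).
  { apply ex_series_ext with (2 := Ha). intros n.
    symmetry; apply Rabs_pos_eq, Cmod_ge_0. }
  assert (Hb' : ex_series (fun n => Rabs (Cmod (b n)))).
  { apply ex_series_ext with (2 := Hb). intros n.
    symmetry; apply Rabs_pos_eq, Cmod_ge_0. }
  destruct Ha as [la Ha]. destruct Hb as [lb Hb].
  apply (@ex_series_le R_AbsRing R_CompleteNormedModule)
    with (2 := ex_intro _ _ (is_series_mult _ _ _ _ Ha Hb Ha' Hb')).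
  intros n. unfold norm; simpl; unfold abs; simpl.
  rewrite Rabs_pos_eq by apply Cmod_ge_0.
  apply Rle_trans with (1 := Cmod_sum_n _ _).
  rewrite sum_n_Reals. right. apply sum_eq. intros k _. apply Cmod_mult.
Qed.

Lemma is_Cseries_mult (a b : nat -> C) (la lb : C) :
  is_Cseries a la -> is_Cseries b lb ->
  ex_series (fun n => Cmod (a n)) -> ex_series (fun n => Cmod (b n)) ->
  is_Cseries (CPS_mult a b) (la * lb)%C.
Proof.
  intros [Ar Ai]%is_Cseries_iff [Br Bi]%is_Cseries_iff
    [Aar Aai]%ex_series_Re_Im [Abr Abi]%ex_series_Re_Im.
  apply is_Cseries_iff; split.
  - generalize (is_series_minus _ _ _ _
      (is_series_mult _ _ _ _ Ar Br Aar Abr)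
      (is_series_mult _ _ _ _ Ai Bi Aai Abi)).
    apply is_series_ext. intros n. unfold CPS_mult.
    rewrite Re_sum_n, sum_n_Reals. symmetry. apply minus_sum.
  - generalize (is_series_plus _ _ _ _
      (is_series_mult _ _ _ _ Ar Bi Aar Abi)
      (is_series_mult _ _ _ _ Ai Br Aai Abr)).
    apply is_series_ext. intros n. unfold CPS_mult.
    rewrite Im_sum_n, sum_n_Reals. symmetry. apply plus_sum.
Qed.

(** ** The generating function of the Mersenne translation polynomials *)

Lemma fact_le_Mfact n : (Factorial.fact n <= Mfact n)%nat.
Proof.
  induction n as [|n IH]; [easy|].
  change (S n * Factorial.fact n <= Mersenne (S n) * Mfact n)%nat.
  apply Nat.mul_le_mono; [|exact IH].
  unfold Mersenne. generalize (Nat.pow_gt_lin_r 2 (S n)). lia.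
Qed.

Lemma INR_Mfact_pos n : 0 < INR (Mfact n).
Proof.
  apply Rlt_le_trans with (1 := INR_fact_lt_0 n).
  apply le_INR, fact_le_Mfact.
Qed.

Lemma CMfact_neq_0 n : CMfact n <> 0.
Proof.
  intros H. injection H. generalize (INR_Mfact_pos n). lra.
Qed.

Lemma eM_abs (z : C) : ex_series (fun n => Cmod (z ^ n / CMfact n)).
Proof.
  apply (@ex_series_le R_AbsRing R_CompleteNormedModule)
    with (b := fun n => / INR (Factorial.fact n) * Cmod z ^ n).
  - intros n. unfold norm; simpl; unfold abs; simpl.
    rewrite Rabs_pos_eq by apply Cmod_ge_0.
    rewrite Cmod_div by apply CMfact_neq_0.
    unfold CMfact. rewrite Cmod_pow, Cmod_R, Rabs_pos_eq
      by apply Rlt_le, INR_Mfact_pos.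
    unfold Rdiv. rewrite Rmult_comm. apply Rmult_le_compat_r.
    + apply pow_le, Cmod_ge_0.
    + apply Rinv_le_contravar; [apply INR_fact_lt_0|].
      apply le_INR, fact_le_Mfact.
  - exists (exp (Cmod z)). apply is_pseries_R, is_exp_Reals.
Qed.

Lemma eM_correct (z : C) : is_Cseries (fun n => z ^ n / CMfact n)%C (eM z).
Proof. apply CSeries_correct, eM_abs. Qed.

Lemma CPS_mult_pow (a b : nat -> C) (t : C) n :
  CPS_mult (fun k => a k * t ^ k)%C (fun k => b k * t ^ k)%C n
  = (CPS_mult a b n * t ^ n)%C.
Proof.
  unfold CPS_mult. rewrite <- (sum_n_mult_r (K := C_Ring) (t ^ n)%C).
  apply sum_n_ext_loc. intros k Hk.
  assert (Ht : (t ^ n = t ^ k * t ^ (n - k))%C).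
  { rewrite <- Cpow_add_r. f_equal. lia. }
  rewrite Ht. unfold mult; simpl. ring.
Qed.

Lemma eM_coef_pow (x t : C) n :
  (eM_coef x n * t ^ n = (x * t) ^ n / CMfact n)%C.
Proof. unfold eM_coef. rewrite Cpow_mult_l. unfold Cdiv. ring. Qed.

Lemma MT_coef_generating (x t : C) (m : nat) :
  ex_series (fun n => Cmod (MT_coef x m n * t ^ n)) /\
  is_Cseries (fun n => MT_coef x m n * t ^ n)%C (eM (x * t) * eM t ^ m)%C.
Proof.
  assert (E : forall y, ex_series (fun n => Cmod (eM_coef y n * t ^ n)) /\
                is_Cseries (fun n => eM_coef y n * t ^ n)%C (eM (y * t))).
  { intros y. split.
    - apply ex_series_ext with (2 := eM_abs (y * t)). intros n.
      now rewrite eM_coef_pow.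
    - generalize (eM_correct (y * t)). apply is_series_ext. intros n.
      now rewrite eM_coef_pow. }
  induction m as [|m [A HS]].
  - replace (eM (x * t) * eM t ^ 0)%C with (eM (x * t)) by (simpl; ring).
    apply E.
  - destruct (E 1) as [A1 S1]. split.
    + apply ex_series_ext with (2 := CPS_mult_abs _ _ A A1). intros n.
      now rewrite CPS_mult_pow.
    + replace (eM (x * t) * eM t ^ S m)%C
        with ((eM (x * t) * eM t ^ m) * eM (1 * t))%C
        by (rewrite Cmult_1_l; simpl; ring).
      generalize (is_Cseries_mult _ _ _ _ HS S1 A A1).
      apply is_series_ext. intros n. apply CPS_mult_pow.
Qed.

Theorem MTpoly_generating (x t : C) (m : nat) :
  is_Cseries (fun n => MTpoly n x m * (t ^ n / CMfact n))%C
    (eM (x * t) * eM t ^ m)%C.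
Proof.
  generalize (proj2 (MT_coef_generating x t m)). apply is_series_ext.
  intros n. unfold MTpoly.
  match goal with |- ?a = ?b => change (@eq C a b) end. field. apply CMfact_neq_0.
Qed.

(* Main.v *)
Require Import Defs.
From Stdlib Require Import Reals Lra Lia.
From Coquelicot Require Import Coquelicot.

(** Expanding [(1 + lam * eM t)^(-r)] by the negative binomial series in
    [lam * eM t] and multiplying by [eM (x * t)] turns the right-hand side into
    a sum over [m] of multiples of [eM (x * t) * eM t ^ m].  Each of these is
    itself a power series in [t], namely the generating function of the
    polynomials [MTpoly n x m].  Summing the resulting double series over [m]
    first gives the values [PhiE], so the theorem amounts to an exchange of the
    two summations.

    The exchange ([is_series_swap]) follows from a bound, summable in [m], for
    all partial sums over [n] of the [m]-th row.  Since [n! <= M_n!], the series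
    of absolute values of [eM (y * t)] is at most [exp (|y| |t|)]; such bounds
    multiply under Cauchy products ([Series_Cmod_CPS_mult_le]), so the
    coefficients of [eM (x * t) * eM t ^ m] have absolute sum at most
    [exp (|x| |t|) * exp |t| ^ m] ([Series_Cmod_MT_coef_le]).  Weighted by the
    binomial coefficients this is summable as soon as [|lam| * exp |t| < 1],
    and because [exp s <= 1 / (1 - s)] this holds on the disc
    [|t| < 1 - |lam|].  The same estimate at one nonzero point of that disc
    shows that the series defining [PhiE] converges. *)

Open Scope R_scope.

(** * Dominated series and exchange of summations *)

Lemma is_series_norm_le {K : AbsRing} {V : NormedModule K}
    (a : nat -> V) (b : nat -> R) (la : V) (lb : R) :
  (forall n, norm (a n) <= b n) -> is_series a la -> is_series b lb ->
  norm la <= lb.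
Proof.
  intros Hle Ha Hb.
  change (Rbar_le (norm la) lb).
  apply is_lim_seq_le with (u := fun n => norm (sum_n a n)) (v := sum_n b).
  - intros n. apply Rle_trans with (1 := norm_sum_n_m a 0 n).
    apply sum_n_m_le, Hle.
  - exact (filterlim_comp _ _ _ _ _ _ _ _ Ha (filterlim_norm la)).
  - exact Hb.
Qed.

Lemma is_series_tail {K : AbsRing} {V : NormedModule K}
    (a : nat -> V) (l : V) (N : nat) :
  is_series a l -> is_series (fun k => a (S N + k)%nat) (minus l (sum_n a N)).
Proof.
  intros Ha. apply is_series_incr_n; [lia|]. simpl Init.Nat.pred.
  refine (eq_ind l (is_series a) Ha _ _). symmetry.
  unfold minus. etransitivity; [symmetry; apply plus_assoc|].
  etransitivity; [apply f_equal, (@plus_opp_l V) | apply plus_zero_r].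
Qed.

Lemma is_series_tail_norm_le {K : AbsRing} {V : NormedModule K}
    (a : nat -> V) (b : nat -> R) (la : V) (lb : R) (N : nat) :
  (forall n, norm (a n) <= b n) -> is_series a la -> is_series b lb ->
  norm (minus la (sum_n a N)) <= lb - sum_n b N.
Proof.
  intros Hle Ha Hb.
  apply (is_series_norm_le (fun k => a (S N + k)%nat) (fun k => b (S N + k)%nat)).
  - intros n. apply Hle.
  - now apply is_series_tail.
  - now apply (is_series_tail b lb N).
Qed.

(** The first [M] rows, each cut after [N] columns, have a sum that converges
    uniformly in [N] as [M] grows, because the remaining rows contribute at most
    a tail of [sum B].  Uniform convergence is what allows the two limits to be
    interchanged. *)
Lemma is_series_swap {K : AbsRing} {V : CompleteNormedModule K}
    (f : nat -> nat -> V) (B : nat -> R) (rows cols : nat -> V) :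
  (forall m, is_series (f m) (rows m)) ->
  (forall m N, norm (sum_n (f m) N) <= B m) -> ex_series B ->
  (forall n, is_series (fun m => f m n) (cols n)) ->
  exists l, is_series rows l /\ is_series cols l.
Proof.
  intros Hrows HB [b Hb] Hcols.
  assert (Hcut : forall N,
    is_series (fun m => sum_n (f m) N) (sum_n cols N)).
  { induction N as [|N IH].
    - rewrite sum_O. apply is_series_ext with (2 := Hcols 0%nat).
      intros m. now rewrite sum_O.
    - rewrite sum_Sn. apply is_series_ext with
        (2 := is_series_plus _ _ _ _ IH (Hcols (S N))).
      intros m. now rewrite sum_Sn. }
  apply (filterlim_switch (U := V) eventually _ eventually _
           (fun M N => sum_n (fun m => sum_n (f m) N) M)).
  - apply (filterlim_locally (F := eventually) (U := fct_UniformSpace nat V)).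
    intros eps.
    generalize (proj1 (filterlim_locally (F := eventually) (sum_n B) b) Hb eps).
    apply filter_imp. intros M HM N.
    apply ball_sym, (norm_compat1 (V := V)).
    apply Rle_lt_trans with (b - sum_n B M).
    + apply (is_series_tail_norm_le (V := V) (fun m => sum_n (f m) N) B);
        [intros m; apply HB | apply Hcut | exact Hb].
    + apply Rle_lt_trans with (1 := Rle_abs _).
      rewrite Rabs_minus_sym. exact HM.
  - induction x as [|M IH].
    + rewrite sum_O. apply filterlim_ext with (2 := Hrows 0%nat).
      intros N. now rewrite sum_O.
    + rewrite sum_Sn.
      apply filterlim_ext with
        (2 := filterlim_comp_2 _ _ plus IH (Hrows (S M))
                (filterlim_plus (V := V) _ _)).
      intros N. now rewrite sum_Sn.
Qed.

(** * Sums of absolute values *)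

Lemma sum_n_Cmod_le_Series (a : nat -> C) (N : nat) :
  ex_series (fun n => Cmod (a n)) ->
  sum_n (fun n => Cmod (a n)) N <= Series (fun n => Cmod (a n)).
Proof.
  intros H. apply is_lim_seq_incr_compare.
  - exact (Series_correct _ H).
  - intros n. rewrite sum_Sn. unfold plus; simpl.
    generalize (Cmod_ge_0 (a (S n))). lra.
Qed.

Lemma Cmod_le_Series (a : nat -> C) (n : nat) :
  ex_series (fun n => Cmod (a n)) ->
  Cmod (a n) <= Series (fun n => Cmod (a n)).
Proof.
  intros H. apply Rle_trans with (2 := sum_n_Cmod_le_Series a n H).
  destruct n as [|n].
  - rewrite sum_O. apply Rle_refl.
  - rewrite sum_Sn. unfold plus; simpl.
    assert (0 <= sum_n (fun n => Cmod (a n)) n); [|lra].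
    apply Rle_trans with (2 := Cmod_sum_n a n), Cmod_ge_0.
Qed.

Lemma Series_Cmod_CPS_mult_le (a b : nat -> C) :
  ex_series (fun n => Cmod (a n)) -> ex_series (fun n => Cmod (b n)) ->
  Series (fun n => Cmod (CPS_mult a b n)) <=
  Series (fun n => Cmod (a n)) * Series (fun n => Cmod (b n)).
Proof.
  intros Ha Hb.
  assert (Habs : forall c : nat -> C, ex_series (fun n => Cmod (c n)) ->
                 ex_series (fun n => Rabs (Cmod (c n)))).
  { intros c. apply ex_series_ext. intros n.
    symmetry; apply Rabs_pos_eq, Cmod_ge_0. }
  assert (Hmul := is_series_mult _ _ _ _ (Series_correct _ Ha)
                    (Series_correct _ Hb) (Habs _ Ha) (Habs _ Hb)).
  rewrite <- (is_series_unique _ _ Hmul).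
  apply Series_le; [|eexists; exact Hmul].
  intros n. split; [apply Cmod_ge_0|].
  apply Rle_trans with (1 := Cmod_sum_n _ _).
  rewrite sum_n_Reals. right. apply sum_eq. intros k _. apply Cmod_mult.
Qed.

Lemma Series_Cmod_eM_le (z : C) :
  Series (fun n => Cmod (z ^ n / CMfact n)) <= exp (Cmod z).
Proof.
  assert (Hexp := proj1 (is_pseries_R _ _ _) (is_exp_Reals (Cmod z))).
  rewrite <- (is_series_unique _ _ Hexp).
  apply Series_le; [|eexists; exact Hexp].
  intros n. split; [apply Cmod_ge_0|].
  rewrite Cmod_div by apply CMfact_neq_0.
  unfold CMfact. rewrite Cmod_pow, Cmod_R, Rabs_pos_eq
    by apply Rlt_le, INR_Mfact_pos.
  unfold Rdiv. rewrite Rmult_comm. apply Rmult_le_compat_r.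
  - apply pow_le, Cmod_ge_0.
  - apply Rinv_le_contravar; [apply INR_fact_lt_0|].
    apply le_INR, fact_le_Mfact.
Qed.

Lemma Cmod_eM_le (z : C) : Cmod (eM z) <= exp (Cmod z).
Proof.
  apply Rle_trans with (2 := Series_Cmod_eM_le z).
  apply (is_series_norm_le (V := C_NormedModule)
           (fun n => z ^ n / CMfact n)%C (fun n => Cmod (z ^ n / CMfact n))).
  - intros n. apply Rle_refl.
  - apply eM_correct.
  - apply Series_correct, eM_abs.
Qed.

Lemma Series_Cmod_MT_coef_le (x t : C) (m : nat) :
  Series (fun n => Cmod (MT_coef x m n * t ^ n)) <=
  exp (Cmod (x * t)) * exp (Cmod t) ^ m.
Proof.
  assert (E : forall y, Series (fun n => Cmod (eM_coef y n * t ^ n))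
                        <= exp (Cmod (y * t))).
  { intros y. apply Rle_trans with (2 := Series_Cmod_eM_le (y * t)).
    right. apply Series_ext. intros n. now rewrite eM_coef_pow. }
  assert (Epos : forall a : nat -> C, ex_series (fun n => Cmod (a n)) ->
                 0 <= Series (fun n => Cmod (a n))).
  { intros a Ha. apply Rle_trans with (2 := Cmod_le_Series a 0 Ha), Cmod_ge_0. }
  induction m as [|m IH].
  - rewrite pow_O, Rmult_1_r. apply E.
  - assert (A := proj1 (MT_coef_generating x t m)).
    assert (A1 := proj1 (MT_coef_generating 1 t 0)). simpl in A1.
    assert (E1 := E (RtoC 1)). rewrite Cmult_1_l in E1.
    replace (exp (Cmod (x * t)) * exp (Cmod t) ^ S m)
      with (exp (Cmod (x * t)) * exp (Cmod t) ^ m * exp (Cmod t))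
      by (simpl; ring).
    apply Rle_trans with
      (2 := Rmult_le_compat _ _ _ _ (Epos _ A) (Epos _ A1) IH E1).
    apply Rle_trans with (2 := Series_Cmod_CPS_mult_le _ _ A A1).
    right. apply Series_ext. intros n. now rewrite CPS_mult_pow.
Qed.

(** * The negative binomial series *)

Lemma Cgeom_abs (z : C) : Cmod z < 1 -> ex_series (fun n => Cmod (1 * z ^ n)).
Proof.
  intros Hz. exists (/ (1 - Cmod z)).
  assert (H : Rabs (Cmod z) < 1) by (rewrite Rabs_pos_eq; [exact Hz | apply Cmod_ge_0]).
  apply is_series_ext with (2 := is_series_geom _ H).
  intros n. now rewrite Cmult_1_l, Cmod_pow.
Qed.

Lemma Cone_minus_neq_0 (z : C) : Cmod z < 1 -> (1 - z)%C <> 0.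
Proof.
  intros Hz H.
  assert (z = 1)%C as -> by (rewrite <- (Cplus_0_r z), <- H; ring).
  rewrite Cmod_1 in Hz. lra.
Qed.

(** Multiplying the absolutely convergent series by [1 - z] leaves only the
    term of index 0, which determines its sum. *)
Lemma is_Cseries_geom (z : C) :
  Cmod z < 1 -> is_Cseries (fun n => 1 * z ^ n)%C (/ (1 - z))%C.
Proof.
  intros Hz.
  assert (Hs := CSeries_correct _ (Cgeom_abs z Hz)).
  set (s := CSeries _) in Hs.
  assert (Hshift : is_Cseries (fun n => 1 * z ^ n)%C (z * s + 1)%C).
  { apply (is_series_decr_1 (V := C_NormedModule)).
    change (is_Cseries (fun n => 1 * z ^ S n)%C (z * s + 1 + - (1 * z ^ 0))%C).
    replace (z * s + 1 + - (1 * z ^ 0))%C with (z * s)%C by (simpl; ring).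
    apply is_series_ext with (2 := is_series_scal z _ _ Hs).
    intros n. unfold scal; simpl. unfold mult; simpl.
    match goal with |- ?a = ?b => change (@eq C a b) end. ring. }
  assert (Heq : s = (z * s + 1)%C)
    by (rewrite <- (is_series_CSeries _ _ Hs); apply is_series_CSeries, Hshift).
  replace (/ (1 - z))%C with s; [exact Hs|].
  apply Cone_minus_neq_0 in Hz.
  transitivity ((s - z * s) / (1 - z))%C; [field; exact Hz|].
  rewrite Heq at 1. field. exact Hz.
Qed.

Lemma binom_0_r (n : nat) : Binomial.C n 0 = 1.
Proof.
  unfold Binomial.C. rewrite Nat.sub_0_r. simpl INR at 2.
  field. apply INR_fact_neq_0.
Qed.

Lemma binom_diag (n : nat) : Binomial.C n n = 1.
Proof. rewrite pascal_step1, Nat.sub_diag by lia. apply binom_0_r. Qed.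

Lemma hockey_stick (q n : nat) :
  sum_n (fun k => Binomial.C (k + q) k) n = Binomial.C (n + S q) n.
Proof.
  induction n as [|n IH].
  - rewrite sum_O. now rewrite !binom_0_r.
  - rewrite sum_Sn, IH.
    replace (S n + S q)%nat with (S (n + S q)) by lia.
    rewrite <- pascal by lia.
    now replace (S n + q)%nat with (n + S q)%nat by lia.
Qed.

(** Induction on [q]: one more factor [1 / (1 - z)] replaces the coefficients
    by their partial sums. *)
Lemma binomial_series (q : nat) (z : C) : Cmod z < 1 ->
  ex_series (fun m => Cmod (RtoC (Binomial.C (m + q) m) * z ^ m)) /\
  is_Cseries (fun m => RtoC (Binomial.C (m + q) m) * z ^ m)%C
    (/ (1 - z) ^ S q)%C.
Proof.
  intros Hz. assert (Hnz := Cone_minus_neq_0 z Hz).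
  induction q as [|q [A HS]].
  - assert (E : forall m,
      (RtoC 1 * z ^ m = RtoC (Binomial.C (m + 0) m) * z ^ m)%C).
    { intros m. now rewrite Nat.add_0_r, binom_diag. }
    split.
    + apply ex_series_ext with (2 := Cgeom_abs z Hz). intros m. now rewrite E.
    + rewrite Cpow_1_r.
      apply is_series_ext with (2 := is_Cseries_geom z Hz). exact E.
  - assert (E : forall m,
      CPS_mult (fun k => RtoC (Binomial.C (k + q) k) * z ^ k)%C
               (fun k => 1 * z ^ k)%C m
      = (RtoC (Binomial.C (m + S q) m) * z ^ m)%C).
    { intros m.
      rewrite (CPS_mult_pow (fun k => RtoC (Binomial.C (k + q) k))
                 (fun _ => RtoC 1)).
      f_equal. rewrite <- hockey_stick. unfold CPS_mult.
      induction m as [|m IH].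
      - rewrite !sum_O. apply Cmult_1_r.
      - rewrite !sum_Sn, IH, Cmult_1_r. unfold plus; simpl. now rewrite RtoC_plus. }
    split.
    + apply ex_series_ext with (2 := CPS_mult_abs _ _ A (Cgeom_abs z Hz)).
      intros m. now rewrite E.
    + replace (/ (1 - z) ^ S (S q))%C with (/ (1 - z) ^ S q * / (1 - z))%C.
      * apply is_series_ext with
          (2 := is_Cseries_mult _ _ _ _ HS (is_Cseries_geom z Hz) A (Cgeom_abs z Hz)).
        exact E.
      * rewrite (Cpow_S _ (S q)). field.
        split; [now apply Cpow_nz | exact Hnz].
Qed.

Definition neg_binom_coef (r : nat) (lam : C) (m : nat) : C :=
  ((- RtoC 1) ^ m * RtoC (Binomial.C (m + r - 1) m) * lam ^ m)%C.

Lemma neg_binom_series (r : nat) (lam e : C) :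
  (1 <= r)%nat -> Cmod (lam * e) < 1 ->
  ex_series (fun m => Cmod (neg_binom_coef r lam m * e ^ m)) /\
  is_Cseries (fun m => neg_binom_coef r lam m * e ^ m)%C
    (/ (1 + lam * e) ^ r)%C.
Proof.
  intros Hr He. destruct r as [|q]; [lia|].
  assert (E : forall m,
    (RtoC (Binomial.C (m + q) m) * (- (lam * e)) ^ m
     = neg_binom_coef (S q) lam m * e ^ m)%C).
  { intros m. unfold neg_binom_coef.
    replace (m + S q - 1)%nat with (m + q)%nat by lia.
    replace (- (lam * e))%C with (- RtoC 1 * (lam * e))%C by ring.
    rewrite !Cpow_mult_l. ring. }
  assert (Hz : Cmod (- (lam * e)) < 1) by now rewrite Cmod_opp.
  destruct (binomial_series q _ Hz) as [A HS]. split.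
  - apply ex_series_ext with (2 := A). intros m. now rewrite E.
  - replace (1 + lam * e)%C with (1 - - (lam * e))%C by ring.
    apply is_series_ext with (2 := HS). exact E.
Qed.

(** * The double series *)

(** Up to the factor [exp |x t|] this is the series of absolute values of the
    negative binomial series at [e = exp |t|]. *)
Lemma ex_series_majorant (r : nat) (x lam t : C) :
  (1 <= r)%nat -> Cmod lam * exp (Cmod t) < 1 ->
  ex_series (fun m => Cmod (neg_binom_coef r lam m) *
                      (exp (Cmod (x * t)) * exp (Cmod t) ^ m)).
Proof.
  intros Hr Ht.
  assert (Hpos : 0 <= exp (Cmod t)) by apply Rlt_le, exp_pos.
  destruct (neg_binom_series r lam (RtoC (exp (Cmod t))) Hr) as [A _].
  { now rewrite Cmod_mult, Cmod_R, Rabs_pos_eq. }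
  apply ex_series_ext with (2 := ex_series_scal_l (exp (Cmod (x * t))) _ A).
  intros m. rewrite (Cmod_mult (neg_binom_coef r lam m)), Cmod_pow, Cmod_R,
    Rabs_pos_eq by exact Hpos.
  unfold scal; simpl. unfold mult; simpl.
  match goal with |- ?a = ?b => change (@eq R a b) end. ring.
Qed.

Lemma mul_exp_lt_1 (s l : R) :
  0 <= l -> 0 <= s < 1 - l -> l * exp s < 1.
Proof.
  intros Hl Hs.
  (* [1 - s <= exp (- s)] bounds [exp s] by [1 / (1 - s)]. *)
  assert (H := exp_ineq1_le (- s)).
  assert (Hinv : exp (- s) * exp s = 1)
    by (rewrite <- exp_plus, Rplus_opp_l; apply exp_0).
  assert (Hpos := exp_pos s). nra.
Qed.

(** A single coefficient is controlled by the sum of its row at a nonzero point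
    [t], as in Cauchy's estimate. *)
Lemma is_Cseries_PhiE (r : nat) (lam : C) (n : nat) (x : C) :
  (1 <= r)%nat -> Cmod lam < 1 ->
  is_Cseries (fun m => neg_binom_coef r lam m * MTpoly n x m)%C
    (PhiE r lam n x).
Proof.
  intros Hr Hlam. apply CSeries_correct.
  set (t := RtoC ((1 - Cmod lam) / 2)).
  assert (Hmod : Cmod t = (1 - Cmod lam) / 2)
    by (unfold t; rewrite Cmod_R; apply Rabs_pos_eq; lra).
  assert (Ht : Cmod lam * exp (Cmod t) < 1).
  { apply mul_exp_lt_1; [apply Cmod_ge_0 | lra]. }
  assert (Htn : 0 < Cmod (t ^ n)) by (rewrite Cmod_pow; apply pow_lt; lra).
  apply (@ex_series_le R_AbsRing R_CompleteNormedModule) with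
    (2 := ex_series_scal_l (Cmod (CMfact n) / Cmod (t ^ n)) _
            (ex_series_majorant r x lam t Hr Ht)).
  intros m. unfold norm; simpl; unfold abs; simpl.
  rewrite Rabs_pos_eq by apply Cmod_ge_0.
  assert (Hcoef := Rle_trans _ _ _
    (Cmod_le_Series _ n (proj1 (MT_coef_generating x t m)))
    (Series_Cmod_MT_coef_le x t m)).
  unfold MTpoly. rewrite !Cmod_mult in *.
  replace (Cmod (neg_binom_coef r lam m) *
           (Cmod (CMfact n) * Cmod (MT_coef x m n)))
    with (Cmod (CMfact n) / Cmod (t ^ n) * (Cmod (neg_binom_coef r lam m) *
          (Cmod (MT_coef x m n) * Cmod (t ^ n)))) by (field; lra).
  apply Rmult_le_compat_l.
  - apply Rdiv_le_0_compat; [apply Cmod_ge_0 | exact Htn].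
  - apply Rmult_le_compat_l; [apply Cmod_ge_0 | exact Hcoef].
Qed.

Lemma PhiE_generating (r : nat) (x lam t : C) :
  (1 <= r)%nat -> Cmod lam < 1 -> Cmod lam * exp (Cmod t) < 1 ->
  Cmod (lam * eM t) < 1 ->
  is_Cseries (fun n => PhiE r lam n x * (t ^ n / CMfact n))%C
    (eM (x * t) / (1 + lam * eM t) ^ r)%C.
Proof.
  intros Hr Hlam Ht HeM.
  set (c := neg_binom_coef r lam).
  set (f := fun m n => (c m * (MT_coef x m n * t ^ n))%C).
  destruct (is_series_swap (V := C_CompleteNormedModule) f
    (fun m => Cmod (c m) * (exp (Cmod (x * t)) * exp (Cmod t) ^ m))
    (fun m => c m * (eM (x * t) * eM t ^ m))%C
    (fun n => PhiE r lam n x * (t ^ n / CMfact n))%C)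
    as [l [Hrows Hcols]].
  - intros m. apply (is_series_scal (V := C_NormedModule) (c m)).
    apply MT_coef_generating.
  - intros m N.
    unfold f. rewrite (sum_n_mult_l (K := C_Ring) (c m)).
    apply Rle_trans with (Cmod (c m) * Cmod (sum_n (fun n => MT_coef x m n * t ^ n)%C N)).
    { right. apply Cmod_mult. }
    apply Rmult_le_compat_l; [apply Cmod_ge_0|].
    apply Rle_trans with (1 := Cmod_sum_n _ _).
    apply Rle_trans with (2 := Series_Cmod_MT_coef_le x t m).
    apply sum_n_Cmod_le_Series, MT_coef_generating.
  - now apply ex_series_majorant.
  - intros n.
    rewrite Cmult_comm.
    apply is_series_ext with (2 := is_series_scal (V := C_NormedModule)
      (t ^ n / CMfact n)%C _ _ (is_Cseries_PhiE r lam n x Hr Hlam)).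
    intros m. unfold f, c, MTpoly, scal; simpl. unfold mult; simpl.
    match goal with |- ?a = ?b => change (@eq C a b) end.
    field. apply CMfact_neq_0.
  - replace (eM (x * t) / (1 + lam * eM t) ^ r)%C with l; [exact Hcols|].
    rewrite <- (is_series_CSeries _ _ Hrows). apply is_series_CSeries.
    apply is_series_ext with (2 := is_series_scal (V := C_NormedModule)
      (eM (x * t)) _ _ (proj2 (neg_binom_series r lam (eM t) Hr HeM))).
    intros m. unfold c, scal; simpl. unfold mult; simpl.
    match goal with |- ?a = ?b => change (@eq C a b) end. ring.
Qed.

Theorem theorem6p2 :
  forall (r : nat) (x lam : C),
    (1 <= r)%nat -> (Cmod lam < 1)%R ->
    @locally C_UniformSpace (RtoC 0) (fun t : C =>
      (Cmod (lam * eM t) < 1)%R /\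
      @is_series C_AbsRing C_NormedModule
        (fun n : nat => (PhiE r lam n x * (t ^ n / CMfact n))%C)
        (eM (x * t) / (RtoC 1 + lam * eM t) ^ r)%C).
Proof.
  intros r x lam Hr Hlam.
  assert (Heps : 0 < 1 - Cmod lam) by lra.
  apply (locally_le_locally_norm (V := C_NormedModule)).
  exists (mkposreal _ Heps). intros t Hball.
  assert (Hsmall : Cmod t < 1 - Cmod lam).
  { replace t with (minus t (RtoC 0)); [exact Hball|].
    unfold minus, plus, opp; simpl. ring. }
  assert (Ht : Cmod lam * exp (Cmod t) < 1).
  { apply mul_exp_lt_1; [apply Cmod_ge_0|].
    split; [apply Cmod_ge_0 | exact Hsmall]. }
  assert (HeM : Cmod (lam * eM t) < 1).
  { apply Rle_lt_trans with (2 := Ht). rewrite Cmod_mult.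
    apply Rmult_le_compat_l; [apply Cmod_ge_0 | apply Cmod_eM_le]. }
  split; [exact HeM|].
  now apply PhiE_generating.
Qed.
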